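(* Let $n\ge1$, let $T$ be a tree on $n$ vertices and let $P_n$ be the path on $n$ vertices. Then $\bar\iota(P_n)\le\bar\iota(T)$.
   Context: For a finite graph $G$, order its vertices uniformly at random and build an independent set $\mathbf I(G)$ by considering the vertices one by one in this order, adding the current vertex if and only if it is not adjacent to any previously added vertex. Then $\bar\iota(G)=\mathbb E\big[|\mathbf I(G)|\big]/|V(G)|$. *)

(* Defs.v *)
From mathcomp Require Import all_boot all_order all_algebra.
Set Implicit Arguments.
Unset Strict Implicit.
Unset Printing Implicit Defensive.
Import GRing.Theory.
Local Open Scope ring_scope.

Record sgraph := SGraph {
  vertex :> finType;
  adj : rel vertex;
  adj_sym : symmetric adj;
  adj_irr : irreflexive adj
}.

Definition graph_connected (G : sgraph) : Prop :=
  (0 < #|G|)%N /\ forall x y : G, connect (@adj G) x y.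

(* [ucycle] alone also accepts [:: x; y] for an edge xy, hence the bound on
   the size. *)
Definition graph_acyclic (G : sgraph) : Prop :=
  forall c : seq G, (2 < size c)%N -> ~ ucycle (@adj G) c.

Definition is_tree (G : sgraph) : Prop :=
  graph_connected G /\ graph_acyclic G.

Definition path_adj (n : nat) : rel 'I_n :=
  [rel i j : 'I_n | (i.+1 == j :> nat) || (j.+1 == i :> nat)].

Lemma path_adj_sym n : symmetric (@path_adj n).
Proof. by move=> i j; rewrite /path_adj /= orbC. Qed.

Lemma path_adj_irr n : irreflexive (@path_adj n).
Proof. by move=> i; rewrite /path_adj /= orbb; apply/negbTE; rewrite gtn_eqF. Qed.

Definition path_graph (n : nat) : sgraph :=
  SGraph (@path_adj_sym n) (@path_adj_irr n).

Definition greedy_step (G : sgraph) (I : {set G}) (v : G) : {set G} :=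
  if [exists u in I, adj u v] then I else v |: I.

Definition greedy_set (G : sgraph) (s : seq G) : {set G} :=
  foldl (@greedy_step G) set0 s.

(* An ordering of the vertices is a duplicate-free tuple of length #|G|;
   expectations are averages over these equally likely orderings. *)
Definition orderings (G : sgraph) : {set #|G|.-tuple G} :=
  [set s : #|G|.-tuple G | uniq s].

Definition expected_greedy_size (G : sgraph) : rat :=
  (\sum_(s in orderings G) #|greedy_set s|%:R) / #|orderings G|%:R.

Definition iota_bar (G : sgraph) : rat :=
  expected_greedy_size G / #|G|%:R.

(* Main.v *)
Require Import Defs.
From mathcomp Require Import all_boot all_order all_algebra.
From mathcomp Require Import ring lra zify.
Set Implicit Arguments.
Unset Strict Implicit.
Unset Printing Implicit Defensive.
Import Order.TTheory GRing.Theory Num.Theory.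
Local Open Scope ring_scope.

(* Write mu n for the expected greedy size of the path on n vertices and
   Phi(S) for the sum of mu |C| over the components C of the forest induced on S.
   Conditioning on the first vertex v that belongs to S reduces the bound
   E|I(S)| >= Phi(S), by induction, to
     |S| + sum_(v in S) Phi(S \ N[v]) >= |S| Phi(S).
   If a vertex u has branches of sizes s_1, ..., s_d in a component of size n,
   then, with Mu n = mu 0 + ... + mu (n - 1), the two sides differ by the sum over
   u of
     (d - 1) sum_i mu s_i + sum_i (Mu s_i - Mu (n - s_i)) + (d - 2) Mu (n - 1),
   because for an edge uw the sizes of the two branches that it joins add up to n.
   This vanishes when d <= 2, so the bound is an equality for paths. For d >= 3
   merging two branches does not increase it: this only involves sums over boxes of the
   second differences of mu, which are (-2)^(r+1) / (r+2)! and have the right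
   signs because they alternate and decay monotonically to third order. *)

(** * Alternating sequences and their window sums *)

(* The sequence [(-1) ^+ r * x r] is monotone of order [k]: its iterated
   differences [u r - u r.+1] up to order [k] are nonnegative. *)
Fixpoint alternating k (x : nat -> rat) : Prop :=
  (forall r, 0 <= (-1) ^+ r * x r) /\
  if k is k'.+1 then alternating k' (fun r => x r + x r.+1) else True.

Lemma alternating_ext k x y : x =1 y -> alternating k x -> alternating k y.
Proof.
elim: k x y => [|k IHk] x y exy /= [x_ge0 alt_x]; split=> [r|];
  rewrite -?exy //.
by apply: IHk alt_x => r; rewrite !exy.
Qed.

Lemma alternatingW k x : alternating k.+1 x -> alternating k x.
Proof.
by elim: k x => [|k IHk] x /= [x_ge0 alt_x]; split=> //; apply: IHk.
Qed.

Lemma alternating0 k : alternating k (fun=> 0).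
Proof.
by elim: k => [|k IHk]; split=> [r|]; rewrite ?mulr0.
Qed.

Lemma alternatingD k x y :
  alternating k x -> alternating k y -> alternating k (fun r => x r + y r).
Proof.
elim: k x y => [|k IHk] x y /= [x_ge0 alt_x] [y_ge0 alt_y].
  by split=> [r|//]; rewrite mulrDr addr_ge0.
split=> [r|]; first by rewrite mulrDr addr_ge0.
apply: alternating_ext (IHk _ _ alt_x alt_y) => r; exact: addrACA.
Qed.

Lemma alternating_shift2 k x :
  alternating k x -> alternating k (fun r => x r.+2).
Proof.
elim: k x => [|k IHk] x /= [x_ge0 alt_x]; split=> [r|] //;
  try by have:= x_ge0 r.+2; rewrite !exprS !mulN1r opprK.
exact: (IHk (fun r => x r + x r.+1)).
Qed.

Lemma natrS n : n.+1%:R = n%:R + 1 :> rat.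
Proof. by rewrite natr1. Qed.

Definition window b (x : nat -> rat) r : rat := \sum_(j < b) x (r + j)%N.

(* Summing consecutive terms in pairs costs one order. *)
Lemma alternating_window k b x :
  alternating k.+1 x -> alternating k (window b x).
Proof.
move=> alt_x; have [n lt_bn] := ubnP b; elim: n b lt_bn => // n IHn [|[|b]] lt_bn.
- by apply: alternating_ext (alternating0 k) => r; rewrite /window big_ord0.
- apply: alternating_ext (alternatingW alt_x) => r.
  by rewrite /window big_ord1 addn0.
have alt_b: alternating k (window b x) by apply: IHn; lia.
(* The two leading terms form one entry of the pairwise sums; the other [b] terms are a window
   shifted by two, which keeps signs. *)
apply: alternating_ext (alternatingD (proj2 alt_x) (alternating_shift2 alt_b)).
move=> r; rewrite /window 2!big_ord_recl -addrA addn0 addn1; congr (_ + (_ + _)).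
by apply: eq_bigr => i _; rewrite /= /bump; congr x; lia.
Qed.

Lemma window_prefix (f : nat -> rat) b r :
  window b f r = \sum_(j < r + b) f j - \sum_(j < r) f j.
Proof. by rewrite big_split_ord /= addrAC subrr add0r. Qed.

Lemma eq_window x y b : x =1 y -> window b x =1 window b y.
Proof. by move=> exy r; apply: eq_bigr => j _. Qed.

Lemma windowB x y b r :
  window b (fun r => x r - y r) r = window b x r - window b y r.
Proof. by rewrite -sumrB. Qed.

Lemma window_shift x c b r : window b (fun r => x (r + c)%N) r = window b x (r + c)%N.
Proof. by apply: eq_bigr => j _; rewrite addnAC. Qed.

(** * Differences of the path values and the resulting inequalities *)

(* [mu n] is the expected greedy size of the path on [n] vertices; [dlt] and
   [eps] are its first and second differences. *)
Definition eps (r : nat) : rat := (-2) ^+ r.+1 / (r.+2)`!%:R.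
Definition dlt (k : nat) : rat := 1 + \sum_(j < k) eps j.
Definition mu (n : nat) : rat := \sum_(k < n) dlt k.
Definition Mu (n : nat) : rat := \sum_(k < n) mu k.

Lemma dltS k : dlt k.+1 = dlt k + eps k.
Proof. by rewrite /dlt big_ord_recr /= addrA. Qed.
Lemma muS n : mu n.+1 = mu n + dlt n.
Proof. by rewrite /mu big_ord_recr. Qed.
Lemma MuS n : Mu n.+1 = Mu n + mu n.
Proof. by rewrite /Mu big_ord_recr. Qed.
Lemma mu0 : mu 0 = 0. Proof. exact: big_ord0. Qed.
Lemma Mu0 : Mu 0 = 0. Proof. exact: big_ord0. Qed.
Lemma mu1 : mu 1 = 1. Proof. by rewrite muS mu0 /dlt big_ord0 add0r addr0. Qed.
Lemma Mu1 : Mu 1 = 0. Proof. by rewrite MuS Mu0 mu0 addr0. Qed.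

Lemma epsS r : (r%:R + 3) * eps r.+1 = - 2 * eps r.
Proof.
rewrite /eps exprS [(r.+3)`!]factS natrM invfM.
have -> : r.+3%:R = r%:R + 3 :> rat by rewrite -addn3 natrD.
have r3 : r%:R + 3 != 0 :> rat by rewrite -natrD pnatr_eq0 addn3.
by field; rewrite r3 /= pnatr_eq0 -lt0n fact_gt0.
Qed.

Lemma epsS_div r : eps r.+1 = - 2 / (r%:R + 3) * eps r.
Proof.
have r3 : r%:R + 3 != 0 :> rat by rewrite -natrD pnatr_eq0 addn3.
by apply: (mulfI r3); rewrite epsS; field.
Qed.

Lemma signed_eps_lt0 r : (-1) ^+ r * eps r < 0.
Proof.
elim: r => [|r IHr].
  by rewrite expr0 mul1r /eps expr1 -[0.+2`!]/2%N; lra.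
have r0 : 0 <= r%:R :> rat by [].
rewrite epsS_div exprS.
have -> : -1 * (-1) ^+ r * (-2 / (r%:R + 3) * eps r)
  = 2 / (r%:R + 3) * ((-1) ^+ r * eps r) by field; lra.
by rewrite pmulr_rlt0 // divr_gt0 // ltr_wpDl.
Qed.

(** Since [eps r.+1 / eps r = -2 / (r + 3)], each iterated difference is [- (-1)^r eps r] times an
    explicit nonnegative rational function of [r]. *)
Lemma alternating_eps : alternating 2 (fun r => - eps r).
Proof.
have u_ge0 r : 0 <= - ((-1) ^+ r * eps r) by rewrite oppr_ge0 ltW ?signed_eps_lt0.
have t_ge0 r : 0 <= r%:R :> rat by apply: ler0n.
split=> [r|]; first by rewrite mulrN.
split=> [r|]; last split=> // r; rewrite !epsS_div ?natrS;
  move: (t_ge0 r) (u_ge0 r); set t := r%:R => t0; set w := (-1) ^+ r => u0.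
  have -> : w * (- eps r - -2 / (t + 3) * eps r)
    = - (w * eps r) * ((t + 1) / (t + 3)) by field; lra.
  by apply: mulr_ge0 => //; apply: divr_ge0; lra.
have -> : w * (- eps r - -2 / (t + 3) * eps r
    + (- (-2 / (t + 3) * eps r) - -2 / (t + 1 + 3) * (-2 / (t + 3) * eps r)))
  = - (w * eps r) * (t * (t + 3) / ((t + 3) * (t + 4))) by field; apply/andP; lra.
by apply: mulr_ge0 => //; apply: divr_ge0; apply: mulr_ge0; lra.
Qed.

(* The third difference has the wrong sign at index 0: there (-1)^r eps r
   carries the factor r^3 + 6 r^2 + 5 r - 8. *)
Lemma alternating_epsS : alternating 3 (fun r => eps r.+1).
Proof.
have u_ge0 r : 0 <= (-1) ^+ r * eps r.+1.
  by have:= signed_eps_lt0 r.+1; rewrite exprS; lra.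
have t_ge0 r : 0 <= r%:R :> rat by apply: ler0n.
split=> [r|]; first exact: u_ge0.
split=> [r|]; last (split=> [r|]; last split=> // r);
  rewrite !(epsS_div _.+1) ?natrS;
  move: (t_ge0 r) (u_ge0 r); set t := r%:R => t0; set w := (-1) ^+ r;
  set z := eps r.+1 => u0.
- have -> : w * (z + -2 / (t + 1 + 3) * z)
    = (w * z) * ((t + 2) / (t + 4)) by field; lra.
  by apply: mulr_ge0 => //; apply: divr_ge0; lra.
- rewrite [X in 0 <= X](_ : _ = (w * z) * ((t + 1) * (t + 4) / ((t + 4) * (t + 5))));
    last by field; apply/andP; lra.
  by apply: mulr_ge0 => //; apply: divr_ge0; apply: mulr_ge0; lra.
rewrite [X in 0 <= X](_ : _ = (w * z) *
    ((t ^+ 3 + 9 * t ^+ 2 + 20 * t + 4) / ((t + 4) * (t + 5) * (t + 6))));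
  last by field; apply/and3P; split; lra.
apply: mulr_ge0 => //; apply: divr_ge0; last by rewrite !mulr_ge0 //; lra.
by rewrite !addr_ge0 ?mulr_ge0 ?exprn_ge0.
Qed.

Lemma dlt_window b r : window b eps r = dlt (r + b) - dlt r.
Proof. by rewrite window_prefix /dlt; ring. Qed.
Lemma mu_window b r : window b dlt r = mu (r + b) - mu r.
Proof. exact: window_prefix. Qed.
Lemma Mu_window b r : window b mu r = Mu (r + b) - Mu r.
Proof. exact: window_prefix. Qed.

(** The defect is the sum of [- eps (i + j)] over i < a and j < b; each of the two window sums costs
    one order of alternation. *)
Lemma mu_subadditive a b : mu (a + b) <= mu a + mu b.
Proof.
have [+ _] := alternating_window a (alternating_window b alternating_eps).
move=> /(_ 0%N); rewrite expr0 mul1r.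
rewrite (@eq_window _ (fun r => dlt r - dlt (r + b)%N)); last first.
  by move=> r; rewrite -opprB -dlt_window /window sumrN.
by rewrite windowB window_shift !mu_window !add0n mu0 [(b + a)%N]addnC; lra.
Qed.

(** The sum of [eps (i + j + k)] over the full box a x b x c is the third difference of [Mu]. The
    three [mu] terms delete its layer k = 0, so that only the shifted sequence [eps r.+1],
    alternating to order 3, remains. *)
Lemma Mu_third_difference a b c : (0 < a)%N -> (0 < b)%N -> (0 < c)%N ->
  0 <= mu a + mu b - mu (a + b) + Mu a + Mu b + Mu c
     - Mu (a + b) - Mu (b + c) - Mu (a + c) + Mu (a + b + c).
Proof.
case: c => // c _ _ _.
have [+ _] := alternating_window a (alternating_window b
  (alternating_window c alternating_epsS)).
move=> /(_ 0%N); rewrite expr0 mul1r.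
rewrite (@eq_window _ (fun r => (mu (r + (b + c.+1))%N - mu (r + c.+1)%N)
   - (mu (r + (b + 1))%N - mu (r + 1)%N))); last first.
  move=> r; rewrite (@eq_window _ (fun r => dlt (r + c.+1)%N - dlt (r + 1)%N)).
    rewrite windowB !window_shift !mu_window.
    by congr (mu _ - _ - (mu _ - _)); lia.
  move=> s; transitivity (window c eps s.+1); first by apply: eq_bigr.
  by rewrite dlt_window; congr (dlt _ - dlt _); lia.
rewrite !windowB !window_shift !Mu_window !add0n ![(_ + a)%N]addnC !addnA !addn1.
by rewrite ![Mu _.+1]MuS Mu0 mu0 ?addnS ?MuS; lra.
Qed.

(** This is the recursion that conditioning on the first vertex of a path on [n.+1] vertices gives,
    here derived from the closed form of [eps]. *)
Lemma Mu_mu n : n.+1%:R * (mu n.+1 - 1) = 2 * Mu n.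
Proof.
(* The first difference of the claim in [n]; differencing once more gives [epsS]. *)
have dlt_mu k : k.+2%:R * dlt k.+1 = 1 + mu k - dlt k.
  elim: k => [|k IHk]; first by rewrite dltS mu0 /dlt big_ord0 /eps.
  rewrite dltS muS; have := epsS k; have := dltS k; rewrite !natrS in IHk *.
  by move: IHk; lra.
elim: n => [|n IHn]; first by rewrite mu1 Mu0; lra.
rewrite muS MuS mulrDr; have := dlt_mu n; have := muS n; move: IHn.
by rewrite !natrS; lra.
Qed.

(** * Nonnegativity of the vertex contributions *)

(* The local contribution of a vertex whose deletion splits its component into
   branches of sizes [s]. *)
Definition vertex_excess (s : seq nat) : rat :=
  ((size s)%:R - 1) * (\sum_(a <- s) mu a)
  + \sum_(a <- s) (Mu a - Mu ((sumn s).+1 - a)%N)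
  + ((size s)%:R - 2) * Mu (sumn s).

Lemma vertex_excess_eq0 s : (size s <= 2)%N -> vertex_excess s = 0.
Proof.
case: s => [|a [|b []]] //= _; rewrite /vertex_excess /=.
- by rewrite !big_nil Mu0; ring.
- by rewrite !big_seq1 addn0 subSnn Mu1; ring.
rewrite !big_cons !big_nil addn0.
have -> : ((a + b).+1 - a = b.+1)%N by lia.
have -> : ((a + b).+1 - b = a.+1)%N by lia.
by rewrite !MuS; ring.
Qed.

Lemma mu_sumn s : mu (sumn s) <= \sum_(a <- s) mu a.
Proof.
elim: s => [|a s IHs] /=; first by rewrite big_nil mu0.
by rewrite big_cons (le_trans (mu_subadditive _ _)) // lerD2l.
Qed.

(** With c the sum of [s], the decrease is the expression of [Mu_third_difference], plus
    [size s - 1] times the subadditivity defect of (a, b), plus the defects of (a, c), of (b, c) and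
    of [s] itself. *)
Lemma vertex_excess_merge a b s : (0 < size s)%N -> all (leq 1) (a :: b :: s) ->
  vertex_excess ((a + b)%N :: s) <= vertex_excess (a :: b :: s).
Proof.
move=> s_gt0 /and3P[a_gt0 b_gt0 s_pos]; rewrite /vertex_excess /= !big_cons.
have c_gt0 : (0 < sumn s)%N by case: s s_gt0 s_pos => //= c s _ /andP[]; lia.
rewrite addnA; set c := sumn s in c_gt0 *; have := mu_sumn s; rewrite -/c.
have -> : ((a + b + c).+1 - a = (b + c).+1)%N by lia.
have -> : ((a + b + c).+1 - b = (a + c).+1)%N by lia.
have -> : ((a + b + c).+1 - (a + b) = c.+1)%N by lia.
set X := \sum_(j <- s) mu j; set Y := \sum_(j <- s) _ => mu_c.
have ab := mu_subadditive a b; have ac := mu_subadditive a c.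
have bc := mu_subadditive b c; have abc := Mu_third_difference a_gt0 b_gt0 c_gt0.
have d_gt0 : 0 <= (size s)%:R - 1 :> rat by rewrite subr_ge0 ler1n.
have D := mulr_ge0 d_gt0 (etrans (subr_ge0 _ _) ab).
by rewrite !MuS !natrS; nra.
Qed.

Lemma vertex_excess_ge0 s : all (leq 1) s -> 0 <= vertex_excess s.
Proof.
have [n] := ubnP (size s); elim: n s => // n IHn [|a [|b [|c s]]] lt_sn s_pos;
  try by rewrite vertex_excess_eq0.
apply: le_trans (vertex_excess_merge _ s_pos) => //; apply: IHn => //.
by case/and3P: s_pos => a_gt0 b_gt0 /=; rewrite addn_gt0 a_gt0.
Qed.

(** * Components and branches of induced forests *)

Section Forest.

Variables (V : finType) (e : rel V).
Implicit Types (S Z : {set V}).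
Hypotheses (e_sym : symmetric e) (e_irr : irreflexive e).

Definition induced S : rel V :=
  [rel x y | [&& x \in S, y \in S & e x y]].
Definition conn S := connect (induced S).
Definition comp S x := [set y | conn S x y].
Definition nbrs S u := [set w in S | e u w].
Definition branch (S : {set V}) u w := #|comp (S :\ u) w|.

Lemma conn0 S x : conn S x x.
Proof. exact: connect0. Qed.

Lemma conn_sym S x y : conn S x y = conn S y x.
Proof.
apply: sym_connect_sym => {}x {}y; rewrite /induced /= e_sym.
by case: (x \in S); case: (y \in S).
Qed.

Lemma conn_trans S y x z : conn S x y -> conn S y z -> conn S x z.
Proof. exact: connect_trans. Qed.

Lemma conn1 S x y : x \in S -> y \in S -> e x y -> conn S x y.
Proof. by move=> xS yS exy; apply: connect1; apply/and3P. Qed.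

Lemma conn_sub S (S' : {set V}) x y : S' \subset S -> conn S' x y -> conn S x y.
Proof.
move=> sS'S; apply: connect_sub => {}x {}y /and3P[xS' yS' exy].
by apply: conn1; rewrite ?(subsetP sS'S).
Qed.

Lemma path_induced_sub S x p : path (induced S) x p -> {subset p <= S}.
Proof.
elim: p x => //= y p IHp x /andP[/and3P[_ yS _] /IHp pS] z.
by rewrite inE => /orP[/eqP->|/pS].
Qed.

Lemma conn_mem S x y : conn S x y -> x \in S -> y \in S.
Proof.
case/connectP=> p /path_induced_sub pS ->; have := mem_last x p.
by rewrite inE => /orP[/eqP->|/pS].
Qed.

Lemma eq_comp S x y : conn S x y -> comp S x = comp S y.
Proof.
move=> cxy; apply/setP=> z; rewrite !inE; apply/idP/idP; last exact: conn_trans.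
by apply: conn_trans; rewrite conn_sym.
Qed.

(** Cut a walk from [x] at its first arrival in [u]; [w] is the vertex just before. *)
Lemma conn_neighbour S x u : conn S x u -> x != u -> x \in S ->
  exists2 w, w \in nbrs S u & conn (S :\ u) x w.
Proof.
case/connectP=> p; elim: p x => [|y p IHp] x /=; first by move=> _ ->; rewrite eqxx.
case/andP=> /and3P[_ yS exy] py lp xu xS.
have [yu|yu] := eqVneq y u.
  by exists x; [rewrite inE xS e_sym -yu | apply: conn0].
have [w wN cyw] := IHp y py lp yu yS; exists w => //.
by apply: conn_trans cyw; apply: conn1; rewrite ?inE ?xu ?yu.
Qed.

Lemma conn_setD S Z x y : (forall z, conn S x z -> z \notin Z) ->
  conn S x y -> conn (S :\: Z) x y.
Proof.
move=> xZ /connectP[p]; elim: p x xZ => [|z p IHp] x xZ /=.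
  by move=> _ ->; apply: conn0.
case/andP=> xz pz lp; have cxz : conn S x z by apply: connect1.
apply: (@conn_trans _ z); last first.
  by apply: IHp => // t czt; apply: xZ; apply: conn_trans czt.
case/and3P: xz => xS zS exz.
apply: conn1 => //; rewrite inE ?xS ?zS andbT; apply: xZ => //; exact: conn0.
Qed.

Lemma comp_setD S Z x : (forall z, conn S x z -> z \notin Z) ->
  comp (S :\: Z) x = comp S x.
Proof.
move=> xZ; apply/setP=> z; rewrite !inE; apply/idP/idP; last exact: conn_setD.
by apply: conn_sub; apply: subsetDl.
Qed.

(** Acyclicity in local form: distinct neighbours of [u] lie in distinct components once [u] is
    deleted. *)
Definition nbrs_separated := forall u w w', e u w -> e u w' ->
  conn (~: [set u]) w w' -> w = w'.
Hypothesis acyc : nbrs_separated.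

Lemma nbrs_inj S u w w' : w \in nbrs S u -> w' \in nbrs S u ->
  conn (S :\ u) w w' -> w = w'.
Proof.
rewrite !inE => /andP[_ uw] /andP[_ uw'] cww'; apply: (acyc uw uw').
by apply: conn_sub cww'; rewrite setDE subsetIr.
Qed.

Lemma nbrs_sym S u w : u \in S -> w \in nbrs S u -> u \in nbrs S w.
Proof. by rewrite !inE => -> /andP[_]; rewrite e_sym. Qed.

Lemma nbrs_neq S u w : w \in nbrs S u -> w != u.
Proof. by rewrite inE => /andP[_ uw]; apply: contraTneq uw => ->; rewrite e_irr. Qed.

Lemma conn_nbrs S u w : u \in S -> w \in nbrs S u -> conn S u w.
Proof. by rewrite !inE => uS /andP[wS uw]; apply: conn1. Qed.

Lemma branch_unique S u x : x \in S -> x != u -> conn S u x ->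
  exists2 w, w \in nbrs S u &
    forall w', w' \in nbrs S u -> conn (S :\ u) x w' = (w' == w).
Proof.
move=> xS xu; rewrite conn_sym => cxu; have [w wN cxw] := conn_neighbour cxu xu xS.
exists w => // w' w'N; apply/idP/eqP => [cxw'|-> //].
by apply: (nbrs_inj w'N wN); apply: conn_trans cxw; rewrite conn_sym.
Qed.

(** The branches at [u] partition its component without [u]. *)
Lemma sum_branches S u (F : V -> rat) : u \in S ->
  \sum_(w in nbrs S u) \sum_(x in comp (S :\ u) w) F x =
  \sum_(x in S | (x != u) && conn S u x) F x.
Proof.
move=> uS.
rewrite (exchange_big_dep (fun x => (x \in S) && ((x != u) && conn S u x))) /=.
  apply: eq_bigr => x /and3P[xS xu cux]; have [w wN eqw] := branch_unique xS xu cux.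
  rewrite (big_pred1 w) // => w'; apply/andP/eqP => [[w'N]|->].
    by rewrite inE conn_sym eqw // => /eqP.
  by split; rewrite // inE conn_sym eqw.
move=> w x wN; rewrite inE => cwx.
have: x \in S :\ u.
  by apply: (conn_mem cwx); rewrite !inE (nbrs_neq wN); move: wN; rewrite inE => /andP[].
rewrite !inE => /andP[-> ->]; apply: conn_trans (conn_nbrs uS wN) _.
by apply: conn_sub cwx; apply: subsetDl.
Qed.

Lemma comp_gt0 S x : (0 < #|comp S x|)%N.
Proof. by apply/card_gt0P; exists x; rewrite inE; apply: conn0. Qed.

Lemma sum_comp_const S x (F : nat -> rat) :
  \sum_(y in comp S x) F #|comp S y| = #|comp S x|%:R * F #|comp S x|.
Proof.
rewrite mulr_natl -sumr_const; apply: eq_bigr => y; rewrite inE => cxy.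
by rewrite (eq_comp cxy).
Qed.

Lemma sum_branch S u : u \in S ->
  (\sum_(w in nbrs S u) branch S u w = #|comp S u|.-1)%N.
Proof.
move=> uS; apply: (@mulrIn rat 1) => //; rewrite natr_sum.
transitivity (\sum_(w in nbrs S u) \sum_(x in comp (S :\ u) w) (1 : rat)).
  by apply: eq_bigr => w _; rewrite sumr_const.
rewrite sum_branches // sumr_const; congr (_ *+ _).
rewrite (cardD1 u (comp S u)) inE conn0 /=; apply: eq_card => x.
rewrite !inE; apply/and3P/andP => [[_ -> ->]|[xu cux]] //; split=> //.
exact: conn_mem cux uS.
Qed.

(** Removing the edge uw splits the component into exactly these two branches. *)
Lemma branch_swap S u w : u \in S -> w \in nbrs S u ->
  branch S u w = (#|comp S w| - branch S w u)%N.
Proof.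
move=> uS wN; have wS : w \in S by move: wN; rewrite inE => /andP[].
have uN := nbrs_sym uS wN; have cuw := conn_nbrs uS wN.
suff -> : #|comp S w| = (branch S u w + branch S w u)%N by rewrite addnK.
rewrite /branch -cardsUI.
(* A common vertex would reach [u] while avoiding [w], through a neighbour [t] other than [w] lying
   in the branch of [w] at [u]. *)
have -> : comp (S :\ u) w :&: comp (S :\ w) u = set0.
  apply/eqP; rewrite -subset0; apply/subsetP=> x; rewrite !inE => /andP[cwx cux].
  have := conn_mem cwx; rewrite !inE (nbrs_neq wN) wS => /(_ isT)/andP[xu xS].
  have := conn_mem cux; rewrite !inE (nbrs_neq uN) uS => /(_ isT)/andP[xw _].
  rewrite conn_sym in cux.
  have [|t tN cxt] := conn_neighbour cux xu; first by rewrite !inE xw.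
  have tN' : t \in nbrs S u by move: tN; rewrite !inE => /andP[/andP[_ ->] ->].
  have := nbrs_neq tN; move: tN; rewrite !inE => /andP[/andP[tw _] _] _.
  case/eqP: tw; apply/esym; apply: (nbrs_inj wN tN'); apply: conn_trans cwx _.
  by apply: conn_sub cxt; rewrite setSD // subsetDl.
rewrite cards0 addn0; apply: eq_card => x; rewrite !inE.
have [xS|xS] := boolP (x \in S); last first.
  by apply/idP/orP => [/conn_mem|[] /conn_mem];
    rewrite ?inE ?wS ?uS ?(nbrs_neq wN) ?(nbrs_neq uN) (negPf xS) ?andbF => /(_ isT).
apply/idP/orP => [cwx|[cwx|cux]].
- have [xw|xw] := eqVneq x w; first by left; rewrite xw; apply: conn0.
  (* [t] is the neighbour of [w] towards [x]. If it is not [u], then [x] reaches [t], hence [w],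
     without meeting [u]. *)
  have [t tN eqt] := branch_unique xS xw cwx.
  have [tu|tu] := eqVneq u t.
    by right; rewrite conn_sym eqt // tu.
  left; rewrite conn_sym.
  have xt : conn (S :\ w) x t by rewrite eqt.
  have xtu : conn (S :\ w :\ u) x t.
    apply: conn_setD xt => z cxz; rewrite inE; apply: contraNneq tu => zu.
    by rewrite -eqt // -zu.
  apply: (@conn_trans _ t); first by apply: conn_sub xtu; rewrite setSD // subsetDl.
  move: tN; rewrite inE => /andP[tS ewt].
  by apply: conn1; rewrite ?inE ?tS ?wS ?(nbrs_neq wN) // ?andbT 1?eq_sym // e_sym.
- by apply: conn_sub cwx; apply: subsetDl.
apply: conn_trans (_ : conn S w u) _; first by rewrite conn_sym.
by apply: conn_sub cux; apply: subsetDl.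
Qed.

(** * The potential and the removal of a closed neighbourhood *)

(** The value [mu |C|] is spread evenly over the vertices of C, so that [Phi] is a sum over vertices
    instead of components. *)
Definition share k : rat := mu k / k%:R.
Definition Phi S : rat := \sum_(x in S) share #|comp S x|.
Definition hood v := v |: [set w | e v w].

Lemma sum_comp_share S x :
  \sum_(y in comp S x) share #|comp S y| = mu #|comp S x|.
Proof.
by rewrite sum_comp_const mulrC divfK // pnatr_eq0 -lt0n comp_gt0.
Qed.

Lemma sum_nbrs_sym S (F : V -> V -> rat) :
  \sum_(v in S) \sum_(u in nbrs S v) F u v = \sum_(u in S) \sum_(v in nbrs S u) F u v.
Proof.
rewrite (exchange_big_dep (mem S)) => [|v u _]; last by rewrite !inE => /andP[].
apply: eq_bigr => u uS; apply: eq_bigl => v; rewrite !inE [u \in S]uS /=.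
by rewrite e_sym.
Qed.

Lemma conn_hood S v z : z \in S -> v \in S -> z \in hood v -> conn S z v.
Proof.
move=> zS vS; rewrite !inE => /orP[/eqP->|vz]; first exact: conn0.
by apply: conn1; rewrite // e_sym.
Qed.

(* [w] is the next vertex on the path from [v] to [x]. *)
Lemma separating_nbr S v x : v \in S -> x \in S -> conn S v x -> x \notin hood v ->
  exists2 w, w \in nbrs S v & (forall u, u \in nbrs S v ->
    [&& x != u, conn S u x & ~~ conn (S :\ u) x v] = (u == w)).
Proof.
move=> vS xS cvx xh; have /norP[xv nvx] : ~~ ((x == v) || e v x).
  by move: xh; rewrite !inE.
have [w wN eqw] := branch_unique xS xv cvx; exists w => // u uN.
have cxw : conn (S :\ v) x w by rewrite eqw.
have [wS vw] : w \in S /\ e v w by move: wN; rewrite inE => /andP.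
apply/and3P/eqP => [[xu cux ncxv]|->].
  apply: contraNeq ncxv => uw; apply: (@conn_trans _ w); last first.
    by apply: conn1; rewrite ?inE ?wS ?vS ?(eq_sym _ u) ?uw ?(nbrs_neq uN) // e_sym.
  apply: (@conn_sub _ (S :\ v :\ u)); first by rewrite setSD // subsetDl.
  apply: conn_setD cxw => z cxz; rewrite inE; apply: contraNneq uw => zu.
  by rewrite -eqw // -zu.
have xw : x != w by apply: contraNneq nvx => ->.
split=> //; first by rewrite conn_sym; apply: conn_sub cxw; apply: subsetDl.
apply/negP=> cxv; have [|t tN cxt] := conn_neighbour cxv xv.
  by rewrite !inE xw.
have tN' : t \in nbrs S v by move: tN; rewrite !inE => /andP[/andP[_ ->] ->].
have /negP[] : t != w by move: tN; rewrite !inE => /andP[/andP[]].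
rewrite -eqw //.
by apply: conn_sub cxt; rewrite setSD // subsetDl.
Qed.

(** Components without [v] survive. Any other remaining vertex [x] sees the same component as if
    only the neighbour [u] of [v] towards [x] had been deleted. *)
Lemma Phi_remove_hood S v : v \in S ->
  Phi (S :\: hood v) =
    \sum_(x in S | ~~ conn S v x) share #|comp S x|
    + \sum_(u in nbrs S v)
        \sum_(x in S | [&& x != u, conn S u x & ~~ conn (S :\ u) x v])
          share #|comp (S :\ u) x|.
Proof.
move=> vS.
(* A component that misses [v] also misses its neighbours, so deleting [hood v] leaves it intact. *)
have far (S' : {set V}) x : x \in S' -> v \in S' -> ~~ conn S' x v ->
    forall z, conn S' x z -> z \notin hood v.
  move=> xS' vS' ncxv z cxz; apply: contra ncxv => zh; apply: (conn_trans cxz).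
  exact: conn_hood (conn_mem cxz xS') vS' zh.
rewrite /Phi (bigID (conn S v)) /= addrC; congr (_ + _).
  apply: eq_big => [x|x /andP[]].
    rewrite in_setD; have [xS|_] := boolP (x \in S); last by rewrite andbF.
    rewrite andbT; case ncvx: (~~ conn S v x); rewrite ?andbF ?andbT //.
    by rewrite conn_sym in ncvx; rewrite (far S x) ?conn0.
  rewrite inE => /andP[_ xS] ncvx; rewrite comp_setD //.
  by apply: far; rewrite // conn_sym.
rewrite (exchange_big_dep (fun x => (x \in S) && conn S v x)) /=; last first.
  move=> u x uN /and4P[-> _ cux _] /=; exact: conn_trans (conn_nbrs vS uN) cux.
(* A vertex of [hood v] other than [u] stays connected to [v] after the deletion of [u], so it
   contributes nothing. *)
rewrite [RHS](bigID (mem (hood v))) /= [X in _ = X + _]big1 ?add0r; last first.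
  move=> x /andP[/andP[xS cvx] xh]; apply: big_pred0 => u; apply/negbTE/negP.
  case/and5P=> uN _ xu _ /negP[].
  by apply: conn_hood; rewrite // !inE ?xS ?vS andbT // eq_sym (nbrs_neq uN).
apply: eq_big => [x|x].
  by rewrite in_setD; case: (x \in S); case: (conn _ _ _); rewrite ?andbF ?andbT.
rewrite in_setD => /andP[/andP[xh xS] cvx].
have [w wN eqw] := separating_nbr vS xS cvx xh.
rewrite (big_pred1 w) => [|u]; last first.
  rewrite xS /=; apply/andP/eqP => [[uN]|->]; first by rewrite eqw // => /eqP.
  by rewrite eqw.
have /and3P[xw _ ncxv] : [&& x != w, conn S w x & ~~ conn (S :\ w) x v] by rewrite eqw.
rewrite -(@comp_setD (S :\ w) (hood v)); last first.
  by apply: far ncxv; rewrite !inE ?xw // eq_sym (nbrs_neq wN).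
congr (share #|comp _ x|); apply/setP=> z; rewrite !inE.
have [->|] //= := eqVneq z w.
by move: wN; rewrite inE => /andP[_ ->]; rewrite orbT.
Qed.

(** * The excess as a sum of vertex contributions *)

Definition branches S u := [seq branch S u w | w <- enum (nbrs S u)].

Lemma all_branches S u : all (leq 1) (branches S u).
Proof. by apply/allP=> _ /mapP[w _ ->]; apply: comp_gt0. Qed.

(* Its sum over the oriented edges vanishes by antisymmetry; it is the term that
   makes the excess of the whole forest a sum of vertex contributions depending
   on branch sizes only. *)
Definition edge_flow S u w : rat :=
  let n := #|comp S u| in let b := branch S u w in
  Mu b - Mu (n - b)%N + Mu n.-1 - b%:R * (mu n - 1).

Lemma Mu_mu_pred n : (0 < n)%N -> n%:R * (mu n - 1) = 2 * Mu n.-1.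
Proof. by case: n => // n _; apply: Mu_mu. Qed.

(** The two branch sizes add up to n, so the sum of both flows is [2 Mu (n - 1) - n (mu n - 1)],
    which is zero by the path recursion. *)
Lemma edge_flow_swap S u w : u \in S -> w \in nbrs S u ->
  edge_flow S w u = - edge_flow S u w.
Proof.
move=> uS wN; rewrite /edge_flow (eq_comp (conn_nbrs uS wN)).
have wS : w \in S by move: wN; rewrite inE => /andP[].
have uw := branch_swap uS wN; have wu := branch_swap wS (nbrs_sym uS wN).
rewrite (eq_comp (conn_nbrs uS wN)) in wu.
rewrite -uw -wu; set n := #|comp S w| in uw wu *.
have nE : n%:R = (branch S u w)%:R + (branch S w u)%:R :> rat.
  have := comp_gt0 (S :\ u) w; have := comp_gt0 (S :\ w) u.
  by rewrite -/(branch S u w) -/(branch S w u) => ? ?; rewrite -natrD; congr (_%:R); lia.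
have := Mu_mu_pred (comp_gt0 S w); rewrite -/n nE; lra.
Qed.

Lemma sum_edge_flow S : \sum_(u in S) \sum_(w in nbrs S u) edge_flow S u w = 0.
Proof.
set F := (X in X = 0); suff: F = - F by lra.
rewrite {1}/F sum_nbrs_sym -sumrN; apply: eq_bigr => u uS; rewrite -sumrN.
by apply: eq_bigr => w wN; rewrite edge_flow_swap.
Qed.

(** Branch sizes add up to n - 1, and [(n - 1) (mu n - 1) = 2 Mu (n - 1) - mu n + 1]; this accounts
    for the factor d - 2 in [vertex_excess]. *)
Lemma vertex_excess_branches S u : u \in S ->
  vertex_excess (branches S u) =
    (#|nbrs S u|%:R - 1) * (\sum_(w in nbrs S u) mu (branch S u w))
    + \sum_(w in nbrs S u) edge_flow S u w + 1 - mu #|comp S u|.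
Proof.
move=> uS; rewrite /vertex_excess size_map -cardE !big_map !big_enum /=.
have -> : sumn (branches S u) = #|comp S u|.-1.
  by rewrite sumnE big_map big_enum sum_branch.
have n_gt0 := comp_gt0 S u; rewrite (ltn_predK n_gt0) /edge_flow.
rewrite !big_split /= sumr_const !sumrN -mulr_suml -natr_sum sum_branch //.
rewrite -[Mu _ *+ _]mulr_natl; have := Mu_mu_pred n_gt0.
have -> : #|comp S u|%:R = #|comp S u|.-1%:R + 1 :> rat by rewrite natr1 prednK.
set X := \sum_(i in _) mu _; set Y := \sum_(i in _) Mu _; set Z := \sum_(i in _) Mu _.
have arith (x y z a b c d : rat) : (c + 1) * (a - 1) = 2 * b ->
    (d - 1) * x + (y - z) + (d - 2) * b =
    (d - 1) * x + (y - z + d * b - c * (a - 1)) + 1 - a by lra.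
by apply: arith.
Qed.

Lemma sum_Phi_remove_hood S :
  #|S|%:R + \sum_(v in S) Phi (S :\: hood v) =
  #|S|%:R * Phi S + \sum_(u in S) vertex_excess (branches S u).
Proof.
rewrite (eq_bigr _ (fun v => @Phi_remove_hood S v)) big_split /=.
rewrite (sum_nbrs_sym S (fun u v => \sum_(x in S | [&& x != u, conn S u x
  & ~~ conn (S :\ u) x v]) share #|comp (S :\ u) x|)).
rewrite (eq_bigr _ (fun u => @vertex_excess_branches S u)) !big_split /=.
rewrite sum_edge_flow addr0 sumrN sumr_const.
have -> : \sum_(v in S) \sum_(x in S | ~~ conn S v x) share #|comp S x|
    = #|S|%:R * Phi S - \sum_(v in S) mu #|comp S v|.
  rewrite mulr_natl -sumr_const -sumrB; apply: eq_bigr => v vS.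
  have -> : mu #|comp S v| = \sum_(x in S | conn S v x) share #|comp S x|.
    rewrite -sum_comp_share; apply: eq_bigl => x; rewrite inE.
    by apply/idP/andP => [cvx|[]//]; split=> //; apply: conn_mem cvx vS.
  by rewrite /Phi (bigID (conn S v) (mem S)) /= [RHS]addrAC subrr add0r.
(* Each [x] is counted once for every neighbour of [u] outside the branch of [x], that is, deg u - 1
   times. *)
suff E u : u \in S -> \sum_(v in nbrs S u) \sum_(x in S | [&& x != u, conn S u x
      & ~~ conn (S :\ u) x v]) share #|comp (S :\ u) x|
    = (#|nbrs S u|%:R - 1) * (\sum_(w in nbrs S u) mu (branch S u w)).
  by rewrite (eq_bigr _ E) -mulr_natr mul1r; ring.
move=> uS; have -> : \sum_(w in nbrs S u) mu (branch S u w)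
    = \sum_(x in S | (x != u) && conn S u x) share #|comp (S :\ u) x|.
  by rewrite -sum_branches //; apply: eq_bigr => w wN; rewrite sum_comp_share.
rewrite mulr_sumr (exchange_big_dep (fun x => (x \in S) && ((x != u) && conn S u x))) /=.
  apply: eq_bigr => x /and3P[xS xu cux]; rewrite sumr_const -[LHS]mulr_natl.
  congr (_ * _).
  have [w wN eqw] := branch_unique xS xu cux.
  rewrite [#|nbrs S u|](cardD1 w) wN natrD addrAC subrr add0r.
  congr (_%:R); apply: eq_card => v.
  rewrite unfold_in /= [in RHS]inE /= xS xu cux /= andbC.
  by case vN: (v \in nbrs S u); rewrite ?andbF //= eqw.
by move=> v x vN /and4P[-> -> -> _].
Qed.

(** * Greedy sums over orderings *)

(** [S] holds the vertices that may still be added. *)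
Fixpoint greedy_count S (s : seq V) : nat :=
  if s is v :: s' then
    if v \in S then (greedy_count (S :\: hood v) s').+1 else greedy_count S s'
  else 0.

(** [U] stands for the vertices not yet drawn. Leaving out the division by [n!] keeps the recursion
    on the first vertex free of fractions. *)
Definition greedy_total n (U S : {set V}) : rat :=
  \sum_(t : n.-tuple V | uniq t && all (mem U) t) (greedy_count S t)%:R.

Lemma big_tuple_cons n (P : pred (seq V)) (F : seq V -> rat) :
  \sum_(t : n.+1.-tuple V | P t) F t =
  \sum_v \sum_(t : n.-tuple V | P (v :: t)) F (v :: t).
Proof.
rewrite pair_big_dep /=.
rewrite (reindex (fun p : V * n.-tuple V => [tuple of p.1 :: p.2])) //=.
exists (fun t : n.+1.-tuple V => (thead t, [tuple of behead t])) => [[v t]|t] _.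
  by congr (_, _); apply: val_inj.
by rewrite /= -tuple_eta.
Qed.

Lemma sum_uniq_tuples n (U : {set V}) : n = #|U| ->
  \sum_(t : n.-tuple V | uniq t && all (mem U) t) (1 : rat) = n`!%:R.
Proof.
move=> nU; rewrite sumr_const; have -> : n`! = #|U| ^_ n by rewrite -nU ffactnn.
rewrite -card_uniq_tuples; congr (_ *+ _).
by apply: eq_card => t; rewrite !inE unfold_in /= andbC.
Qed.

Lemma uniq_cons_in (U : {set V}) v (t : seq V) :
  uniq (v :: t) && all (mem U) (v :: t) =
  (v \in U) && (uniq t && all (mem (U :\ v)) t).
Proof.
have -> : all (mem (U :\ v)) t = (v \notin t) && all (mem U) t.
  elim: t => //= x t ->; rewrite !inE negb_or (eq_sym x).
  by case: (v == x); case: (x \in U); case: (v \in t).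
by rewrite /=; case: (v \in U); case: (v \in t); rewrite ?andbF.
Qed.

Lemma greedy_totalS n (U S : {set V}) : #|U| = n.+1 -> S \subset U ->
  greedy_total n.+1 U S =
    \sum_(v in S) (n`!%:R + greedy_total n (U :\ v) (S :\: hood v))
    + \sum_(v in U :\: S) greedy_total n (U :\ v) S.
Proof.
move=> cardU sSU; rewrite /greedy_total.
rewrite (@big_tuple_cons n (fun s => uniq s && all (mem U) s)
  (fun s => (greedy_count S s)%:R)).
transitivity (\sum_(v in U) \sum_(t : n.-tuple V | uniq t && all (mem (U :\ v)) t)
    (greedy_count S (v :: t))%:R : rat).
  rewrite [RHS]big_mkcond; apply: eq_bigr => v _; case: ifP => vU.
    by apply: eq_bigl => t; rewrite uniq_cons_in vU.
  by apply: big_pred0 => t; rewrite uniq_cons_in vU.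
rewrite (big_setID S) /= (setIidPr sSU); congr (_ + _); apply: eq_bigr => v.
  move=> vS; rewrite -(@sum_uniq_tuples n (U :\ v)); last first.
    by move: cardU; rewrite (cardsD1 v) (subsetP sSU) // => -[].
  by rewrite -big_split /=; apply: eq_bigr => t _; rewrite vS -natr1 addrC.
by rewrite inE => /andP[/negPf vS _]; apply: eq_bigr => t _; rewrite /= vS.
Qed.

(** The sign of [c] lets one induction serve both directions: 1 gives the lower bound for trees, -1
    the upper bound for paths. *)
Lemma greedy_total_bound (c : rat) n (U S : {set V}) :
  (forall S u, u \in S -> 0 <= c * vertex_excess (branches S u)) ->
  #|U| = n -> S \subset U -> c * (n`!%:R * Phi S) <= c * greedy_total n U S.
Proof.
move=> exc_ge0; elim: n U S => [|n IHn] U S cardU sSU.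
  move: sSU; rewrite (cards0_eq cardU) subset0 => /eqP->.
  rewrite /greedy_total /Phi big_set0 !mulr0 big1 ?mulr0 // => t _.
  by rewrite tuple0.
rewrite greedy_totalS //.
have cardUv v : v \in U -> #|U :\ v| = n.
  by move=> vU; move: cardU; rewrite (cardsD1 v) vU => -[].
rewrite mulrDr [c * \sum_(v in S) _]mulr_sumr [c * \sum_(v in U :\: S) _]mulr_sumr.
have le1 : \sum_(v in S) c * (n`!%:R * (1 + Phi (S :\: hood v))) <=
    \sum_(v in S) c * (n`!%:R + greedy_total n (U :\ v) (S :\: hood v)).
  apply: ler_sum => v vS; have vU := subsetP sSU v vS.
  rewrite mulrDr mulr1 !mulrDr lerD2l; apply: IHn; first exact: cardUv.
  apply: subset_trans (_ : S :\ v \subset _); last exact: setSD.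
  by apply: setDS; rewrite sub1set !inE eqxx.
have le2 : \sum_(v in U :\: S) c * (n`!%:R * Phi S) <=
    \sum_(v in U :\: S) c * greedy_total n (U :\ v) S.
  apply: ler_sum => v; rewrite inE => /andP[vS vU]; apply: IHn; first exact: cardUv.
  by rewrite subsetD1 sSU vS.
apply: le_trans (lerD le1 le2).
have excess_ge0 : 0 <= c * n`!%:R * \sum_(u in S) vertex_excess (branches S u).
  rewrite mulrAC mulr_ge0 // mulr_sumr sumr_ge0 // => u uS; exact: exc_ge0.
have -> : \sum_(v in U :\: S) c * (n`!%:R * Phi S) =
    (n.+1%:R - #|S|%:R) * (c * (n`!%:R * Phi S)).
  by rewrite sumr_const cardsDS // -[LHS]mulr_natl natrB ?subset_leq_card // cardU.
(* First vertices inside and outside [S] give [|S|] and [n + 1 - |S|] copies of [n! Phi S], together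
   [(n + 1)! Phi S]; the excess is left over. *)
rewrite -!mulr_sumr big_split /= sumr_const sum_Phi_remove_hood.
by move: excess_ge0; rewrite factS natrM; lra.
Qed.

Lemma Phi_connected : (forall x y : V, connect e x y) -> (0 < #|V|)%N ->
  Phi setT = mu #|V|.
Proof.
move=> e_conn V_gt0; have compT x : comp setT x = setT.
  apply/setP=> y; rewrite !inE /conn (@eq_connect _ _ e) ?e_conn // => a b.
  by rewrite /induced /= !inE.
rewrite /Phi (eq_bigr (fun=> share #|V|)) => [|x _]; last by rewrite compT cardsT.
by rewrite sumr_const cardsT -mulr_natl mulrC divfK // pnatr_eq0 -lt0n.
Qed.

End Forest.

(** * From the greedy set of a graph to the recursive count *)

Section Greedy.

Variable G : sgraph.

Definition available (I : {set G}) :=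
  [set v | (v \notin I) && ~~ [exists u in I, adj u v]].

(** The induction is over an arbitrary current set [I]: the final size is [|I|] plus the count
    started from [available I]. *)
Lemma card_greedy_set (s : seq G) :
  #|greedy_set s| = greedy_count (@adj G) setT s.
Proof.
have -> : setT = available set0.
  apply/setP=> v; rewrite !inE /=; apply/esym/existsPn => u.
  by rewrite inE.
rewrite /greedy_set -[RHS]add0n -(cards0 G); elim: s set0 => [|v s IHs] I /=.
  by rewrite addn0.
rewrite IHs /greedy_step !inE; case: ifP => [_|/negbT noadj]; first by rewrite andbF.
rewrite andbT; case vI: (v \in I) => /=; first by rewrite (setUidPr _) ?sub1set.
rewrite cardsU1 vI add1n addSnnS; congr (_ + (greedy_count _ _ _).+1)%N.
apply/setP=> w; rewrite !inE !negb_or -!andbA; congr (_ && _).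
have -> : [exists u in v |: I, adj u w] = adj v w || [exists u in I, adj u w].
  apply/existsP/orP => [[u /andP[]]|[vw|/existsP[u /andP[uI uw]]]].
  - rewrite !inE => /orP[/eqP->|uI uw]; [by left|right].
    by apply/existsP; exists u; rewrite uI.
  - by exists v; rewrite !inE eqxx.
  - by exists u; rewrite !inE uI orbT.
by rewrite negb_or; case: (w \in I); rewrite ?andbF.
Qed.

Lemma expected_greedy_sizeE :
  expected_greedy_size G = greedy_total (@adj G) #|G| setT setT / #|G|`!%:R.
Proof.
have P (t : #|G|.-tuple G) : (t \in orderings G) = uniq t && all (mem [set: G]) t.
  by rewrite inE (_ : all _ t) ?andbT //; apply/allP=> x _; apply: in_setT.
rewrite /expected_greedy_size /greedy_total; congr (_ / _).
  by apply: eq_big => [t|t _]; rewrite ?P // card_greedy_set.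
rewrite -(@sum_uniq_tuples _ _ [set: G]) ?cardsT // sumr_const.
by congr (_ *+ _); apply: eq_card => t; rewrite P unfold_in.
Qed.

Lemma expected_greedy_size_bound (c : rat) :
  graph_connected G ->
  nbrs_separated (@adj G) ->
  (forall (S : {set G}) u, u \in S ->
     0 <= c * vertex_excess (branches (@adj G) S u)) ->
  c * mu #|G| <= c * expected_greedy_size G.
Proof.
move=> [G_gt0 G_conn] acyc exc_ge0.
have f_gt0 : 0 < #|G|`!%:R :> rat by rewrite ltr0n fact_gt0.
rewrite expected_greedy_sizeE mulrA ler_pdivlMr // -mulrA [mu _ * _]mulrC.
rewrite -(@Phi_connected _ (@adj G)) //.
apply: greedy_total_bound => //; first exact: adj_sym; first exact: adj_irr.
by rewrite cardsT.
Qed.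

(** A simple path between distinct neighbours of [u] that avoids [u] closes up through [u] to a
    cycle of length at least 3. *)
Lemma acyclic_nbrs : graph_acyclic G -> nbrs_separated (@adj G).
Proof.
move=> acyc u w w' uw uw' /connectP[p wp lp].
case/shortenP: wp lp => {}p wp uniq_p _ lp.
case: p wp uniq_p lp => // x p wp uniq_p lp; case: (acyc (u :: w :: x :: p)) => //.
have sub : subrel (induced (@adj G) (~: [set u])) (@adj G) by move=> a b /and3P[].
rewrite /ucycle; apply/andP; split; last first.
  rewrite cons_uniq uniq_p andbT inE negb_or; apply/andP; split.
    by apply: contraTneq uw => <-; rewrite adj_irr.
  by apply/negP=> /(path_induced_sub wp); rewrite !inE eqxx.
rewrite /cycle rcons_path [last _ _](esym lp) adj_sym uw' andbT.
by apply/andP; split; last exact: sub_path wp.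
Qed.

End Greedy.

(** * Trees, paths and the comparison *)

Lemma tree_expected_greedy_size (T : sgraph) :
  is_tree T -> mu #|T| <= expected_greedy_size T.
Proof.
move=> [T_conn /acyclic_nbrs acyc].
rewrite -[mu _]mul1r -[expected_greedy_size T]mul1r.
apply: expected_greedy_size_bound => // S u _; rewrite mul1r.
exact/vertex_excess_ge0/all_branches.
Qed.

Lemma path_graph_connected n : (0 < n)%N -> graph_connected (path_graph n).
Proof.
case: n => // n _; split; first by rewrite card_ord.
have from0 (x : path_graph n.+1) : connect (@adj (path_graph n.+1)) ord0 x.
  case: x => m; elim: m => [|m IHm] lt_m.
    by rewrite (_ : Ordinal _ = ord0) ?connect0 //; apply: val_inj.
  apply: connect_trans (IHm (ltnW lt_m)) (connect1 _).
  by rewrite /= /path_adj /= eqxx.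
move=> x y; apply: connect_trans (from0 y).
by rewrite (sym_connect_sym (@adj_sym _)).
Qed.

(** Off [u] no edge leads from the indices below [u] to those above, and each side contains at most
    one neighbour of [u]. *)
Lemma path_graph_nbrs n : nbrs_separated (@adj (path_graph n)).
Proof.
move=> u w w' uw uw' cww'.
have eq_side : (w < u)%N = (w' < u)%N.
  apply: (@closed_connect _ (induced (@adj _) (~: [set u]))
    [pred x : 'I_n | (x < u)%N]) cww'.
  move=> a b /and3P[]; rewrite !inE /= /path_adj /= => /eqP au /eqP bu ab.
  have {}au : (a : nat) <> u by move/val_inj.
  have {}bu : (b : nat) <> u by move/val_inj.
  by lia.
by apply: val_inj; move: uw uw'; rewrite /= /path_adj /=; lia.
Qed.

Lemma path_graph_degree n S (u : path_graph n) :
  (#|nbrs (@adj (path_graph n)) S u| <= 2)%N.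
Proof.
rewrite cardE -(size_map val) (@uniq_leq_size _ _ [:: u.-1; u.+1]) //.
  by rewrite map_inj_uniq ?enum_uniq //; apply: val_inj.
move=> _ /mapP[w + ->]; rewrite mem_enum inE /= /path_adj /= !inE => /andP[_].
by lia.
Qed.

Lemma path_expected_greedy_size n : (0 < n)%N ->
  expected_greedy_size (path_graph n) <= mu n.
Proof.
move=> n_gt0; rewrite -lerN2 -mulN1r -[- expected_greedy_size _]mulN1r.
rewrite -{1}(card_ord n).
apply: expected_greedy_size_bound; first exact: path_graph_connected.
  exact: path_graph_nbrs.
move=> S u _; rewrite vertex_excess_eq0 ?mulr0 //.
by rewrite size_map -cardE path_graph_degree.
Qed.

Theorem theorem1p4 (n : nat) (hn : (1 <= n)%N) (T : sgraph)
    (hT : is_tree T) (hcard : #|T| = n) :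
  iota_bar (path_graph n) <= iota_bar T.
Proof.
rewrite /iota_bar hcard card_ord ler_pM2r ?invr_gt0 ?ltr0n //.
apply: le_trans (path_expected_greedy_size hn) _.
by rewrite -hcard tree_expected_greedy_size.
Qed.
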